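(* Let $\{f_m,\mathcal F_m\}_{m=0}^\infty$ be a regular supermartingale relative to a convex set of equivalent measures $M$. Let $G$ be the set of adapted non-decreasing processes $g=\{g_m\}_{m=0}^\infty$, $g_0=0$, such that $\{f_m+g_m\}_{m=0}^\infty$ is a supermartingale relative to $M$. Then for the maximal element $g^0=\{g^0_m\}_{m=0}^\infty$ in a certain maximal chain $\tilde G\subseteq G$ the equalities $$E^{P_0}(f_m+g^0_m)=f_0,\qquad m=1,2,\dots,\ P_0\in M,$$ are valid. There exists a martingale $\{\bar M_m,\mathcal F_m\}_{m=0}^\infty$ relative to the family of measures $M$ such that $$f_m=\bar M_m-g^0_m,\qquad m=1,2,\dots.$$ Moreover, for this martingale the representation $$\bar M_m=E^{P_0}\{f_\infty+g^0_\infty|\mathcal F_m\},\qquad m=1,2,\dots,\ P_0\in M,$$ holds, where $f_\infty+g^0_\infty=\lim_{m\to\infty}(f_m+g^0_m)$.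
   Context: $(\Omega,\mathcal F)$ is a measurable space with a filtration $\mathcal F_m\subset\mathcal F_{m+1}\subset\mathcal F$, $m\ge0$, and $\mathcal F_0=\{\emptyset,\Omega\}$. All measures are probability measures; equivalent means mutually absolutely continuous. $E^P$ denotes (conditional) expectation with respect to $P$; relations between random variables hold almost surely. An adapted process $\{f_m\}_{m=0}^\infty$ is a supermartingale relative to a family of measures $M$ if $E^P|f_m|<\infty$ for $m\ge1$, $P\in M$, and $E^P\{f_m|\mathcal F_k\}\le f_k$ for $0\le k\le m$, $P\in M$; it is a martingale relative to $M$ if these inequalities are equalities. Sets of adapted non-decreasing processes starting at $0$ are partially ordered by: $g_1\preceq g_2$ iff $P(g^2_m-g^1_m\ge0)=1$ for all $m\ge1$, where $g_i=\{g^i_m\}$; (maximal) chains and maximal elements refer to $\preceq$. Regular supermartingale. Let $\{f_m,\mathcal F_m\}_{m=0}^\infty$ be a supermartingale relative to a convex set of equivalent measures $M$ such that $|f_m|\le\varphi$ for all $m\ge0$ and $E^Q\varphi<T<\infty$ for all $Q\in M$, with a random variable $\varphi$ and a real number $T$ not depending on $Q\in M$. It is called regular if there exists an adapted nonnegative process $\bar g^0=\{\bar g^0_m\}_{m=0}^\infty$, $\bar g^0_0=0$, $E^P\bar g^0_m<\infty$ ($m\ge1$, $P\in M$), such that for every finite family $\hat P_1,\dots,\hat P_s\in M$ satisfying $0<l\le\frac{d\hat P_i}{d\hat P_j}\le L<\infty$, $i,j=1,\dots,s$ (with $l,L$ real numbers depending on the family), the following hold. Put $\hat M_s=\{\sum_{i=1}^s\gamma_i\hat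 P_i:\gamma_i\ge0,\sum_{i=1}^s\gamma_i=1\}$ and let $G_s$ be the set of adapted non-decreasing processes $\{g_m\}_{m=0}^\infty$, $g_0=0$, for which $\{f_m+g_m\}_{m=0}^\infty$ is a supermartingale relative to all measures from $\hat M_s$. (i) There exist a natural number $1\le m_0<\infty$ and an $\mathcal F_{m_0-1}$-measurable nonnegative random variable $\varphi^s_{m_0}$ with $\hat P_1(\varphi^s_{m_0}>0)>0$ such that $f_{m_0-1}-E^{\hat P_i}\{f_{m_0}|\mathcal F_{m_0-1}\}\ge\varphi^s_{m_0}$, $i=1,\dots,s$. (ii) For the maximal element $g^s=\{g^s_m\}_{m=0}^\infty$ in a certain maximal chain $\tilde G_s\subseteq G_s$, $E^{\hat P_i}\{f_m+g^s_m|\mathcal F_k\}=f_k+g^s_k$ for $0\le k\le m$, $m\ge1$, $i=1,\dots,s$. (iii) $E^{\hat P_i}\{g^s_m-g^s_{m-1}|\mathcal F_{m-1}\}=E^{\hat P_i}\{\bar g^0_m|\mathcal F_{m-1}\}$ for $m\ge1$, $i=1,\dots,s$. *)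

(* Defs.v *)
From HB Require Import structures.
From mathcomp Require Export all_boot all_order all_algebra.
From mathcomp Require Export all_classical all_reals all_analysis.
Export Order.TTheory GRing.Theory Num.Theory.
Export numFieldNormedType.Exports.
Set Implicit Arguments.
Unset Strict Implicit.
Unset Printing Implicit Defensive.
Local Open Scope classical_set_scope.
Local Open Scope ring_scope.

Section Defs.
Context {d : measure_display} {T : measurableType d} {R : realType}.
Implicit Types (P Q : probability T R) (M : set (probability T R)).
Implicit Types (F : nat -> set (set T)) (G : set (set T)).
Implicit Types (X Y : T -> R) (f g : nat -> T -> R).

Definition filtration F : Prop :=
  [/\ forall m, sigma_algebra setT (F m),
      forall m, F m `<=` F m.+1 &
      forall m, F m `<=` measurable].

Definition measurable_wrt G X : Prop :=
  measurable_fun [set: g_sigma_algebraType G] (X : g_sigma_algebraType G -> R).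

Definition adapted F f : Prop := forall m, measurable_wrt (F m) (f m).

Definition integrable_rv P X : Prop := P.-integrable setT (EFin \o X).

Definition is_condexp P G X : set (T -> R) :=
  [set Y | [/\ integrable_rv P X, measurable_wrt G Y, integrable_rv P Y &
    forall A, G A ->
      (\int[P]_(x in A) (Y x)%:E = \int[P]_(x in A) (X x)%:E)%E]].

(* A version of E^P{X | G}, determined up to P-null sets when X is integrable;
   the junk value 0 is taken only when there is no version. *)
Definition condexp P G X : T -> R := xget (cst 0) (is_condexp P G X).

(* A relation between random variables that holds almost surely
   for every measure of the family M. *)
Definition as_all M (H : T -> Prop) : Prop :=
  forall P, M P -> {ae P, forall x, H x}.

(* Elements of probability T R are set functions on all subsets of T and are
   compared on measurable sets only; hence the existential. *)
Definition convex_measures M : Prop :=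
  forall P Q, M P -> M Q -> forall t : R, 0 <= t <= 1 ->
  exists2 P', M P' & forall A, measurable A ->
    (P' A = t%:E * P A + (1 - t)%:E * Q A)%E.

Definition equivalent_measures M : Prop :=
  forall P Q, M P -> M Q -> P `<< Q.

Definition convex_comb s (Ps : 'I_s -> probability T R) :
    set (probability T R) :=
  [set Q | exists gam : 'I_s -> R,
    [/\ forall i, 0 <= gam i, \sum_i gam i = 1 &
        forall A, measurable A -> (Q A = \sum_i (gam i)%:E * Ps i A)%E]].

Definition supermartingale F M f : Prop :=
  [/\ adapted F f,
      forall m P, (1 <= m)%N -> M P -> integrable_rv P (f m) &
      forall k m, (k <= m)%N ->
        forall P, M P -> {ae P, forall x, condexp P (F k) (f m) x <= f k x}].

Definition martingale F M f : Prop :=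
  [/\ adapted F f,
      forall m P, (1 <= m)%N -> M P -> integrable_rv P (f m) &
      forall k m, (k <= m)%N ->
        forall P, M P -> {ae P, forall x, condexp P (F k) (f m) x = f k x}].

(* The sets G (for the whole family) and G_s (for the family convex_comb Ps). *)
Definition compensators F M f : set (nat -> T -> R) :=
  [set g | [/\ adapted F g,
      forall x, g 0%N x = 0,
      forall m, as_all M (fun x => g m x <= g m.+1 x) &
      supermartingale F M (fun m => f m \+ g m)]].

Definition proc_le M g1 g2 : Prop :=
  forall m, (1 <= m)%N -> forall P, M P ->
    P [set x | 0 <= g2 m x - g1 m x] = 1%E.

End Defs.

Section Chains.
Context {U : Type} (le : U -> U -> Prop).

Definition maximal_chain (A C : set U) : Prop :=
  [/\ C `<=` A, total_on C le &
      forall C', C' `<=` A -> total_on C' le -> C `<=` C' -> C' = C].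

(* le is only a preorder on processes: g and h with le g h and le h g are
   almost surely equal. *)
Definition maximal_element (C : set U) (g : U) : Prop :=
  C g /\ forall h, C h -> le g h -> le h g.

End Chains.

Section Regular.
Context {d : measure_display} {T : measurableType d} {R : realType}.
Implicit Types (M : set (probability T R)) (F : nat -> set (set T)).

Definition bounded_ratios s (Ps : 'I_s -> probability T R) (l L : R) : Prop :=
  forall i j, {ae Ps j, forall x,
    (l%:E <= Radon_Nikodym (charge_of_finite_measure (Ps i)) (Ps j) x
         <= L%:E)%E}.

Definition regular_supermartingale F M (f : nat -> T -> R) : Prop :=
  [/\ supermartingale F M f,
      exists (phi : T -> R) (B : R),
        [/\ measurable_fun setT phi,
            forall m, as_all M (fun x => `|f m x| <= phi x) &
            forall Q, M Q -> ('E_Q[phi] < B%:E)%E] &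
      exists gbar : nat -> T -> R,
        [/\ adapted F gbar,
            forall m, as_all M (fun x => 0 <= gbar m x),
            forall x, gbar 0%N x = 0,
            forall m P, (1 <= m)%N -> M P -> ('E_P[gbar m] < +oo)%E &
            forall (s : nat) (Ps : 'I_s.+1 -> probability T R) (l L : R),
              (forall i, M (Ps i)) -> 0 < l -> bounded_ratios Ps l L ->
              (exists (m0 : nat) (phis : T -> R),
                [/\ (1 <= m0)%N,
                    measurable_wrt (F m0.-1) phis,
                    as_all (range Ps) (fun x => 0 <= phis x),
                    (0 < Ps ord0 [set x | (0 < phis x)%R])%E &
                    forall i, {ae Ps i, forall x,
                      phis x <=
                      f m0.-1 x - condexp (Ps i) (F m0.-1) (f m0) x}]) /\
              (exists (Gs : set (nat -> T -> R)) (gs : nat -> T -> R),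
                [/\ maximal_chain (proc_le (convex_comb Ps))
                      (compensators F (convex_comb Ps) f) Gs,
                    maximal_element (proc_le (convex_comb Ps)) Gs gs,
                    forall k m i, (k <= m)%N -> (1 <= m)%N ->
                      {ae Ps i, forall x,
                        condexp (Ps i) (F k) (f m \+ gs m) x
                        = f k x + gs k x} &
                    forall m i, (1 <= m)%N ->
                      {ae Ps i, forall x,
                        condexp (Ps i) (F m.-1) (gs m \- gs m.-1) x
                        = condexp (Ps i) (F m.-1) (gbar m) x}])]].

End Regular.

(* Main.v *)
From HB Require Import structures.
From mathcomp Require Import measurable_realfun lra.
Require Import Defs.
Set Implicit Arguments.
Unset Strict Implicit.
Unset Printing Implicit Defensive.
Local Open Scope classical_set_scope.
Local Open Scope ring_scope.

(** Regularity supplies one process gbar serving every finite family of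
measures, and it is enough to look at the families with a single member P.
For such a family f + g^s is a P-martingale, so the conditional drift of f
under P is minus that of g^s, which in turn is minus that of gbar:
E^P{f_m + gbar_m | F_(m-1)} = f_(m-1). The partial sums
g_m = gbar_1 + ... + gbar_m do not depend on P, and therefore f + g is a
martingale under all measures of M at once ([regular_compensator]).

Everything else follows from this identity. The process g belongs to G, and
any h in G above g satisfies E^P(f_m + h_m) <= f_0 = E^P(f_m + g_m), hence
h = g almost surely ([fair_compensator_maximal]); so g is a maximal element
of each maximal chain through it, and Zorn's lemma gives such a chain
([maximal_chain_exists]). Next, E^P g_m = f_0 - E^P f_m is bounded in m,
whence f + g is dominated by an integrable variable, namely the bound on f
plus the limit of g ([fair_dominated]). By Doob's theorem the martingale f + g
converges almost surely ([fair_cvg]), and dominated convergence under the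
integrals over the events of F_m shows that the limit closes it
([fair_closed]).

Two classical tools are developed on the way. The first is the existence of
conditional expectations, as Radon-Nikodym derivatives on the sub-sigma-algebra
([is_condexp_exists]): an equation between values of [condexp] carries
information only once these values are known to be actual versions. The second
is Doob's convergence theorem, by counting upcrossings. *)

(** * Conditional expectations *)

Section Condexp.
Context {d : measure_display} {T : measurableType d} {R : realType}.
Implicit Types (P : probability T R) (G : set (set T)) (X Y Z : T -> R).

Lemma EFin_Rintegral P X (A : set T) : measurable A -> integrable_rv P X ->
  (\int[P]_(x in A) X x)%:E = (\int[P]_(x in A) (X x)%:E)%E.
Proof.
move=> mA iX; rewrite fineK//; apply: integrable_fin_num => //.
exact: (integrableS measurableT).
Qed.

Lemma integrable_rvD P X Y :
  integrable_rv P X -> integrable_rv P Y -> integrable_rv P (X \+ Y).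
Proof. by move=> iX iY; have := integrableD measurableT iX iY; apply. Qed.

Lemma integrable_rvB P X Y :
  integrable_rv P X -> integrable_rv P Y -> integrable_rv P (X \- Y).
Proof. by move=> iX iY; have := integrableB measurableT iX iY; apply. Qed.

Lemma integrable_rv_addKl P X Y :
  integrable_rv P (X \+ Y) -> integrable_rv P X -> integrable_rv P Y.
Proof.
move=> iXY iX; rewrite (_ : Y = (X \+ Y) \- X); first exact: integrable_rvB.
by apply/funext => x /=; rewrite addrAC subrr add0r.
Qed.

Lemma RintegralD_rv P X Y A : measurable A ->
  integrable_rv P X -> integrable_rv P Y ->
  \int[P]_(x in A) (X x + Y x) = \int[P]_(x in A) X x + \int[P]_(x in A) Y x.
Proof.
by move=> mA iX iY; apply: RintegralD => //; exact: (integrableS measurableT).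
Qed.

Lemma RintegralB_rv P X Y A : measurable A ->
  integrable_rv P X -> integrable_rv P Y ->
  \int[P]_(x in A) (X x - Y x) = \int[P]_(x in A) X x - \int[P]_(x in A) Y x.
Proof.
by move=> mA iX iY; apply: RintegralB => //; exact: (integrableS measurableT).
Qed.

Lemma integrable_rv_measurable P X : integrable_rv P X -> measurable_fun setT X.
Proof. by move=> /(measurable_int P)/measurable_EFinP. Qed.

Lemma ae_eq_Rintegral P X Y A : measurable A ->
  measurable_fun setT X -> measurable_fun setT Y ->
  {ae P, forall x, X x = Y x} ->
  \int[P]_(x in A) X x = \int[P]_(x in A) Y x.
Proof.
move=> mA mX mY XY; congr fine; apply: ae_eq_integral => //.
- exact/measurable_EFinP/measurable_funTS.
- exact/measurable_EFinP/measurable_funTS.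
- by apply: filterS XY => x /= -> _.
Qed.

Lemma ae_le_Rintegral P X Y A : measurable A ->
  integrable_rv P X -> integrable_rv P Y ->
  {ae P, forall x, X x <= Y x} ->
  \int[P]_(x in A) X x <= \int[P]_(x in A) Y x.
Proof.
move=> mA iX iY XY.
have mX := integrable_rv_measurable iX; have mY := integrable_rv_measurable iY.
rewrite -subr_ge0 -RintegralB_rv//.
(* truncating at 0 makes the almost sure inequality hold everywhere *)
rewrite (@ae_eq_Rintegral _ _ (fun x => Num.max (Y x - X x) 0))//.
- by apply: Rintegral_ge0 => x _; rewrite le_max lexx orbT.
- exact: measurable_funB.
- by apply: measurable_maxr => //; exact: measurable_funB.
- by apply: filterS XY => x XYx; rewrite max_l// subr_ge0.
Qed.

Section SubSigma.
Variables (P : probability T R) (G : set (set T)).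
Hypotheses (sG : sigma_algebra setT G) (GT : G `<=` measurable).

Lemma measurable_wrtP X :
  measurable_wrt G X <-> forall B, measurable B -> G (X @^-1` B).
Proof.
split=> [mX B mB|mX _ B mB].
  rewrite -(measurable_g_measurableTypeE sG) -[X in measurable X]setTI.
  exact: mX.
by rewrite setTI (measurable_g_measurableTypeE sG); exact: mX.
Qed.

Lemma measurable_wrt_fun X : measurable_wrt G X -> measurable_fun setT X.
Proof. by move=> /measurable_wrtP mX _ B mB; rewrite setTI; apply/GT/mX. Qed.

(** The identity, from the full sigma-algebra to [G]: pushing [P] forward along
it is restricting [P] to [G], and gives access to the theorems on measures over
the smaller sigma-algebra. *)
Let forget : T -> g_sigma_algebraType G := id.

Let mforget : measurable_fun setT forget.
Proof.
by move=> _ B; rewrite setTI (measurable_g_measurableTypeE sG); exact: GT.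
Qed.

HB.instance Definition _ := isMeasurableFun.Build _ _ _ _ forget mforget.

Let P' : probability (g_sigma_algebraType G) R :=
  distribution P forget.

Let integrable_forget X : integrable_rv P X -> measurable_wrt G X ->
  P'.-integrable setT (EFin \o X).
Proof.
move=> iX mX; apply: integrable_pushforward => //; exact/measurable_EFinP.
Qed.

Let integral_forget X A : integrable_rv P X -> measurable_wrt G X -> G A ->
  (\int[P']_(x in A) (X x)%:E = \int[P]_(x in A) (X x)%:E)%E.
Proof.
move=> iX mX GA; rewrite [LHS]integral_pushforward//.
- exact/measurable_EFinP.
- by apply: integrableS iX => //; exact: GT.
- by rewrite (measurable_g_measurableTypeE sG).
Qed.

Lemma is_condexp_unique X Y Z :
  is_condexp P G X Y -> is_condexp P G X Z -> {ae P, forall x, Y x = Z x}.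
Proof.
move=> [iX mY iY eY] [_ mZ iZ eZ].
have [|||N [mN N0 YZN]] := @integral_ae_eq _ _ _ P' setT measurableT
    (EFin \o Z) (EFin \o Y).
- exact: integrable_forget.
- exact/measurable_EFinP.
- move=> E _; rewrite (measurable_g_measurableTypeE sG) => GE.
  by rewrite !integral_forget// eY ?eZ.
exists N; split => //.
  by apply: GT; rewrite -(measurable_g_measurableTypeE sG).
apply: subset_trans YZN => x /=; apply: contra_not => /(_ I) [].
exact.
Qed.

(** The signed measure A |-> \int_A X dP is absolutely continuous with respect
to P, also after restriction to [G]; its density there is the conditional
expectation, being [G]-measurable by construction. *)
Lemma is_condexp_exists X : integrable_rv P X -> is_condexp P G X !=set0.
Proof.
move=> iX.
have numu : pushforward (induced_charge iX) forget `<< P'.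
  apply: dominates_pushforward => //; apply/null_content_dominatesP => A mA PA.
  apply: null_set_integral => //.
  exact/measurable_funTS/(measurable_int P iX).
pose y' := Radon_Nikodym (pushforward (induced_charge iX) forget) P'.
pose y := y' mforget.
have yfin x : y x \is a fin_num by exact: Radon_Nikodym_fin_num.
have iy : P'.-integrable setT y by exact: Radon_Nikodym_integrable.
have yE : EFin \o (fine \o y) = y by apply/funext => x /=; rewrite fineK.
have mY : measurable_wrt G (fine \o y).
  by apply/measurable_EFinP; rewrite yE; exact: measurable_int iy.
have iY : integrable_rv P (fine \o y).
  apply/integrableP; split; first exact/measurable_EFinP/measurable_wrt_fun.
  rewrite yE; have /integrableP[my] := iy.
  by rewrite ge0_integral_pushforward//; exact: measurableT_comp.
exists (fine \o y); split => // A GA.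
rewrite -integral_forget//.
transitivity (\int[P']_(x in A) y x)%E.
  by apply: eq_integral => x _; rewrite /= fineK.
have mA : measurable (A : set (g_sigma_algebraType G)).
  by rewrite (measurable_g_measurableTypeE sG).
by rewrite -(Radon_Nikodym_integral numu).
Qed.

Lemma condexpP X : integrable_rv P X -> is_condexp P G X (condexp P G X).
Proof. by move=> /is_condexp_exists[Y XY]; exact: xgetI XY. Qed.

Lemma is_condexp_ae_eq X Y :
  is_condexp P G X Y -> {ae P, forall x, condexp P G X x = Y x}.
Proof.
by move=> XY; apply: is_condexp_unique (XY); apply: condexpP; case: XY.
Qed.

Lemma Rintegral_condexp X A : integrable_rv P X -> G A ->
  \int[P]_(x in A) condexp P G X x = \int[P]_(x in A) X x.
Proof. by move=> /condexpP[_ _ _ /[apply]]; rewrite /Rintegral => ->. Qed.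

Lemma condexp_integrable X :
  integrable_rv P X -> integrable_rv P (condexp P G X).
Proof. by move=> /condexpP[]. Qed.

End SubSigma.

Lemma Radon_Nikodym_self P :
  {ae P, forall x, Radon_Nikodym (charge_of_finite_measure P) P x = 1%E}.
Proof.
have PP : charge_of_finite_measure P `<< P by move=> A.
apply: filterS (@integral_ae_eq _ _ _ P setT measurableT (cst 1%E)
    (Radon_Nikodym (charge_of_finite_measure P) P) _ _ _) => [x /(_ I)//|||].
- exact: Radon_Nikodym_integrable.
- exact: measurable_cst.
- by move=> E _ mE; rewrite -Radon_Nikodym_integral// integral_cst// mul1e.
Qed.

End Condexp.

(** * Upcrossings of a real sequence *)

Section Upcrossings.
Context {R : realType}.
Variables (a b : R).
Implicit Types (u : nat -> R).

(** State of the strategy that starts at a value below [a] and stops at the next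
value above [b]: [rising u k] holds when an upcrossing of [a, b] is under way
at time [k]. It depends on [u 0], ..., [u k] only. *)
Fixpoint rising u k : bool :=
  if k is k'.+1 then (if rising u k' then u k <= b else u k < a)
  else u 0%N < a.

Definition upcrossings u n : nat :=
  \sum_(k < n) (rising u k && (b < u k.+1)%R).

(** The discrete stochastic integral of the strategy [rising]: what is won by
holding one unit of [u] during the upcrossings. *)
Definition gain u n : R :=
  \sum_(k < n) (if rising u k then u k.+1 - u k else 0).

(** Each completed upcrossing wins at least [b - a]; the correction pays for an
upcrossing that is still under way at time [n]. *)
Lemma upcrossings_le_gain u n :
  (b - a) * (upcrossings u n)%:R <=
  gain u n + (if rising u n then a - u n else 0).
Proof.
elim: n => [|n ih].
  rewrite /upcrossings /gain !big_ord0 mulr0 add0r /=.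
  by case: ltP => // /ltW; rewrite subr_ge0.
move: ih; rewrite /upcrossings /gain !big_ord_recr /=.
rewrite -/(upcrossings u n) -/(gain u n) natrD.
case: (rising u n) => /=.
  by case: leP => /= h; rewrite ?addr0 ?mulrDr ?mulr1; lra.
by case: ltP => h; rewrite ?addr0; lra.
Qed.

Hypothesis ab : a <= b.

Lemma rising_lt u k : u k < a -> rising u k.
Proof.
case: k => //= k uka; case: ifP => // _.
by rewrite ltW// (lt_le_trans uka).
Qed.

Lemma rising_gt u k : b < u k -> ~~ rising u k.
Proof.
case: k => /= [|k] buk; first by rewrite -leNgt ltW// (le_lt_trans ab).
by case: ifP => _; rewrite ?leNgt ?buk// -leNgt ltW// (le_lt_trans ab).
Qed.

Lemma upcrossings_le u k l :
  (k <= l)%N -> (upcrossings u k <= upcrossings u l)%N.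
Proof.
move=> /subnK <-; elim: (l - k)%N => // n ih.
by rewrite addSn /upcrossings big_ord_recr /= (leq_trans ih)// leq_addr.
Qed.

(** The state can only be left by passing above [b], which is what
[upcrossings] counts. *)
Lemma upcrossings_lt u k l : (k <= l)%N -> rising u k -> ~~ rising u l ->
  (upcrossings u k < upcrossings u l)%N.
Proof.
move=> + uk; elim: l => [|l ih]; first by rewrite leqn0 => /eqP <-; rewrite uk.
rewrite leq_eqVlt => /predU1P[<-|kl]; first by rewrite uk.
have [ul|/(ih kl) ukl _] /= := boolP (rising u l); last first.
  by rewrite (leq_trans ukl)// upcrossings_le.
rewrite ul -ltNge => bul.
by rewrite /upcrossings big_ord_recr /= ul bul /= addn1 ltnS upcrossings_le.
Qed.

Lemma upcrossings_unbounded u :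
  (forall n, exists2 k, (n <= k)%N & u k < a) ->
  (forall n, exists2 k, (n <= k)%N & b < u k) ->
  forall K, exists n, (K <= upcrossings u n)%N.
Proof.
move=> ua ub; elim=> [|K [n Kn]]; first by exists 0%N.
have [k nk uk] := ua n; have [l kl ul] := ub k; exists l.
apply: leq_ltn_trans (upcrossings_lt kl (rising_lt uk) (rising_gt ul)).
by rewrite (leq_trans Kn)// upcrossings_le.
Qed.

End Upcrossings.

(** * Convergence from the absence of oscillation *)

Section Oscillation.
Context {R : realType}.
Implicit Types (u : nat -> R).

Definition oscillates (a b : R) u :=
  (forall n, exists2 k, (n <= k)%N & u k < a) /\
  (forall n, exists2 k, (n <= k)%N & b < u k).

Lemma ereal_rat_between (x y : \bar R) :
  (x < y)%E -> exists2 p : rat, (x < (ratr p)%:E)%E & ((ratr p)%:E < y)%E.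
Proof.
have H (r s : R) : r < s ->
    exists2 p : rat, (r%:E < (ratr p)%:E)%E & ((ratr p)%:E < s%:E)%E.
  move=> /rat_in_itvoo[p]; rewrite in_itv/= => /andP[rp ps].
  by exists p; rewrite lte_fin.
case: x y => [r||] [s||]//.
- by rewrite lte_fin; exact: H.
- move=> _; have [|p rp _] := H r (r + 1); first by rewrite ltrDl.
  by exists p => //; exact: ltry.
- move=> _; have [|p _ ps] := H (s - 1) s; first by rewrite ltrBlDr ltrDl.
  by exists p => //; exact: ltNyr.
- by move=> _; exists 0; [exact: ltNyr|exact: ltry].
Qed.

(** Two rationals strictly between the lower and the upper limit would be
crossed infinitely often, so both limits agree. Rationals are what makes the
condition a countable one, as needed for almost sure statements. *)
Lemma nonoscillating_cvg u :
  (forall p q : rat, p < q -> ~ oscillates (ratr p) (ratr q) u) ->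
  (u k)%:E @[k --> \oo] --> limn_einf (EFin \o u).
Proof.
move=> osc; set v := EFin \o u.
have einfE : limn_einf v = ereal_sup (range (einfs v)).
  by rewrite limn_einf_lim; apply/cvg_lim => //; exact: cvg_einfs_sup.
have esupE : limn_esup v = ereal_inf (range (esups v)).
  by rewrite limn_esup_lim; apply/cvg_lim => //; exact: cvg_esups_inf.
have einf_esup : limn_einf v = limn_esup v.
  apply/eqP; rewrite eq_le limn_einf_sup leNgt; apply/negP.
  move=> /ereal_rat_between[p lp /ereal_rat_between[q pq qL]].
  rewrite lte_fin ltr_rat in pq.
  apply: (osc _ _ pq); split => n.
    have : (einfs v n < (ratr p)%:E)%E.
      apply: le_lt_trans lp.
      by rewrite einfE; apply: ereal_sup_ubound; exists n.
    by move=> /ereal_inf_lt[_ [k nk <-]]; rewrite lte_fin; exists k.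
  have : ((ratr q)%:E < esups v n)%E.
    apply: (lt_le_trans qL).
    by rewrite esupE; apply: ereal_inf_lbound; exists n.
  by move=> /ereal_sup_gt[_ [k nk <-]]; rewrite lte_fin; exists k.
apply: (@squeeze_cvge _ _ _ _ (einfs v) _ (esups v)).
- apply: nearW => n; apply/andP; split.
    by apply: ereal_inf_lbound; exists n => /=.
  by apply: ereal_sup_ubound; exists n => /=.
- by rewrite limn_einf_lim; exact: is_cvg_einfs.
- by rewrite einf_esup limn_esup_lim; exact: is_cvg_esups.
Qed.

End Oscillation.

(** * Doob's convergence theorem *)

Section Doob.
Context {d : measure_display} {T : measurableType d} {R : realType}.
Implicit Types (P : probability T R) (F : nat -> set (set T)).
Implicit Types (X : nat -> T -> R).

(** A martingale under the single measure [P]. Comparing integrals over events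
avoids any choice of versions of conditional expectations, and one step is
enough because the sigma-algebras increase. *)
Definition fair_process P F X :=
  [/\ adapted F X, forall m, integrable_rv P (X m) &
    forall m A, F m A -> \int[P]_(x in A) X m.+1 x = \int[P]_(x in A) X m x].

Lemma filtration_le F k m : filtration F -> (k <= m)%N -> F k `<=` F m.
Proof.
move=> [_ Fle _] /subnK <-; elim: (m - k)%N => // n ih.
by rewrite addSn; apply: subset_trans ih _; exact: Fle.
Qed.

Lemma fair_Rintegral P F X k m A :
  filtration F -> fair_process P F X -> (k <= m)%N ->
  F k A -> \int[P]_(x in A) X m x = \int[P]_(x in A) X k x.
Proof.
move=> hF [_ _ fX] /subnK <- FA; elim: (m - k)%N => // n <-.
by rewrite addSn fX//; apply: filtration_le FA => //; rewrite leq_addl.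
Qed.

Lemma fair_condexp P F X k m :
  filtration F -> fair_process P F X -> (k <= m)%N ->
  is_condexp P (F k) (X m) (X k).
Proof.
move=> hF fX km; have [aX iX _] := fX; split => // A FA.
have mA : measurable A by have [_ _] := hF; apply; exact: FA.
by rewrite -!EFin_Rintegral// (fair_Rintegral hF fX km FA).
Qed.

Lemma integrable_limn_nondecreasing P (U : nat -> T -> \bar R) (K : R) :
  (forall n, measurable_fun setT (U n)) -> (forall n x, (0 <= U n x)%E) ->
  (forall x, {homo U ^~ x : n m / (n <= m)%N >-> (n <= m)%E}) ->
  (forall n, (\int[P]_x U n x <= K%:E)%E) ->
  P.-integrable setT (fun x => limn (U ^~ x)).
Proof.
move=> mU U0 ndU UK.
have cU x : cvgn (U ^~ x) by exact: ereal_nondecreasing_is_cvgn.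
have L0 x : (0 <= limn (U ^~ x))%E.
  by apply: lime_ge => //; apply: nearW => n; exact: U0.
apply/integrableP; split.
  exact: (emeasurable_fun_cvg U (fun x => limn (U ^~ x)) mU (fun x _ => cU x)).
under eq_integral do rewrite gee0_abs//.
rewrite monotone_convergence//.
apply: (@le_lt_trans _ _ K%:E); last exact: ltry.
apply: lime_le; last exact: nearW.
apply: ereal_nondecreasing_is_cvgn => n m nm.
by apply: ge0_le_integral => // x _; exact: ndU.
Qed.

Lemma measurable_limn_einf (U : nat -> T -> \bar R) :
  (forall n, measurable_fun setT (U n)) ->
  measurable_fun setT (fun x => limn_einf (U ^~ x)).
Proof.
move=> mU; apply: measurableT_comp => //.
by apply: measurable_fun_limn_esup => n; exact: measurableT_comp.
Qed.

Section ExpectedUpcrossings.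
Variables (P : probability T R) (F : nat -> set (set T)) (X : nat -> T -> R).
Hypotheses (hF : filtration F) (fX : fair_process P F X).

Let path x : nat -> R := X ^~ x.

Let mX m : measurable_fun setT (X m).
Proof. by have [_ iX _] := fX; exact: integrable_rv_measurable. Qed.

Lemma rising_adapted a b k : F k [set x | rising a b (path x) k].
Proof.
have [sF Fle FT] := hF; have [aX _ _] := fX.
have XF n B : measurable B -> F n (X n @^-1` B).
  by move: B; apply/(measurable_wrtP (sF n)); exact: aX.
have ltF n : F n [set x | X n x < a].
  by rewrite -[X in F n X]/(X n @^-1` `]-oo, a[); exact: XF.
have leF n : F n [set x | X n x <= b].
  by rewrite -[X in F n X]/(X n @^-1` `]-oo, b]); exact: XF.
elim: k => [|k ih]; first exact: ltF.
rewrite (_ : [set _ | _] =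
  ([set x | rising a b (path x) k] `&` [set x | X k.+1 x <= b]) `|`
  (~` [set x | rising a b (path x) k] `&` [set x | X k.+1 x < a])).
  have := measurable_g_measurableTypeE (sF k.+1).
  move=> E; rewrite -[F k.+1]E.
  apply: measurableU; apply: measurableI; rewrite ?E//.
  - exact: Fle.
  - by rewrite -E; apply: measurableC; rewrite E; exact: Fle.
apply/seteqP; split => x /=; rewrite /path.
  by case: ifP => r; [left|right].
by case=> -[]; [move=> ->|move=> /negP/negbTE ->].
Qed.

(** No strategy wins on average against a fair process: the increment from [n]
to [n + 1] is collected on the event [rising], which belongs to [F n]. *)
Lemma gain_expectation a b n :
  integrable_rv P (fun x => gain a b (path x) n) /\
  \int[P]_x gain a b (path x) n = 0.
Proof.
have [_ _ FT] := hF; have [_ iX fairX] := fX.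
elim: n => [|n [ig g0]].
  have -> : (fun x => gain a b (path x) 0) = cst 0.
    by apply/funext => x; rewrite /gain big_ord0.
  by rewrite Rintegral_cst// mul0r; split => //; exact: integrable0.
pose A := [set x | rising a b (path x) n].
have FA : F n A by exact: rising_adapted.
have mA : measurable A by exact: FT FA.
pose D := X n.+1 \- X n.
have DA x : (if rising a b (path x) n then path x n.+1 - path x n else 0) =
    (D \_ A) x.
  by rewrite patchE /D/= mem_setE.
have iD : integrable_rv P D by exact: integrable_rvB.
have iDA : integrable_rv P (D \_ A).
  rewrite /integrable_rv (_ : _ \o _ = (EFin \o D) \_ A); last first.
    by rewrite -restrict_EFin.
  by apply/(integrable_mkcond _ mA)/(integrableS measurableT).
have -> : (fun x => gain a b (path x) n.+1) =
    (fun x => gain a b (path x) n) \+ (D \_ A).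
  by apply/funext => x; rewrite /gain big_ord_recr DA.
split; first exact: integrable_rvD.
rewrite RintegralD_rv// g0 add0r -Rintegral_mkcond RintegralB_rv//.
by rewrite fairX ?subrr.
Qed.

Let measurable_upcrossings a b n :
  measurable_fun setT (fun x => (upcrossings a b (path x) n)%:R : R).
Proof.
have [_ _ FT] := hF.
elim: n => [|n ih].
  rewrite (_ : (fun _ => _) = cst 0) //.
  by apply/funext => x; rewrite /upcrossings big_ord0.
pose B := [set x | rising a b (path x) n] `&` X n.+1 @^-1` `]b, +oo[.
have mB : measurable B.
  apply: measurableI; first by apply: FT; exact: rising_adapted.
  by rewrite -[X in measurable X]setTI; exact: mX.
rewrite (_ : (fun _ => _) =
    (fun x => (upcrossings a b (path x) n)%:R) \+ \1_B).
  exact: measurable_funD.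
apply/funext => x /=; rewrite /upcrossings big_ord_recr/= natrD; congr (_ + _).
rewrite indicE /B in_setI; congr (nat_of_bool (_ && _))%:R.
  by rewrite mem_setE.
by apply/idP/idP; rewrite inE/= in_itv/= andbT.
Qed.

(** Doob's upcrossing inequality: the expected gain vanishes, so the expected
correction in [upcrossings_le_gain] bounds the number of upcrossings. *)
Lemma upcrossings_expectation a b n K : a < b ->
  (\int[P]_x `|X n x|%:E <= K%:E)%E ->
  (\int[P]_x (upcrossings a b (path x) n)%:R%:E <= ((K + `|a|) / (b - a))%:E)%E.
Proof.
move=> ab XK; have ba0 : 0 < b - a by rewrite subr_gt0.
have [_ iX _] := fX.
have [ig g0] := gain_expectation a b n.
have iabs : integrable_rv P (fun x => `|X n x|).
  by have := integrable_abse (iX n); apply.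
have ia : integrable_rv P (cst `|a|).
  exact: finite_measure_integrable_cst.
have iabsa := integrable_rvD iabs ia.
have le_gain x : (b - a) * (upcrossings a b (path x) n)%:R <=
    gain a b (path x) n + (`|X n x| + `|a|).
  apply: le_trans (upcrossings_le_gain _ _ _ _) _; rewrite lerD2l.
  case: ifP => _; last by rewrite addr_ge0.
  by rewrite addrC lerD// ?ler_norm// -normrN ler_norm.
have U0 x : 0 <= (b - a) * (upcrossings a b (path x) n)%:R.
  by rewrite mulr_ge0// ltW.
rewrite EFinM lee_pdivlMr// muleC -ge0_integralZl//;
  [|exact/measurable_EFinP|by rewrite lee_fin ltW].
apply: (@le_trans _ _ (\int[P]_x
    (gain a b (path x) n + (`|X n x| + `|a|))%:E)%E).
  apply: ge0_le_integral => //.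
  - by move=> x _; rewrite -EFinM lee_fin.
  - apply/measurable_EFinP; exact: measurable_funM.
  - apply/measurable_EFinP/integrable_rv_measurable.
    exact: integrable_rvD ig iabsa.
  - by move=> x _; rewrite -EFinM lee_fin.
rewrite -EFin_Rintegral//; last exact: integrable_rvD ig iabsa.
rewrite RintegralD_rv//.
rewrite g0 add0r RintegralD_rv// Rintegral_cst//.
rewrite (_ : fine _ = 1) ?mulr1; last by rewrite [X in fine X]probability_setT.
by rewrite !EFinD leeD// EFin_Rintegral.
Qed.

(** The total number of upcrossings has a finite expectation by monotone
convergence, hence is almost surely finite. *)
Lemma ae_nonoscillating a b K : a < b ->
  (forall m, (\int[P]_x `|X m x|%:E <= K%:E)%E) ->
  {ae P, forall x, ~ oscillates a b (path x)}.
Proof.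
move=> ab XK.
pose U n x : \bar R := (upcrossings a b (path x) n)%:R%:E.
have mU n : measurable_fun setT (U n) by exact/measurable_EFinP.
have U0 n x : setT x -> (0 <= U n x)%E by move=> _; rewrite lee_fin.
have ndU x : setT x -> {homo U^~ x : n m / (n <= m)%N >-> (n <= m)%E}.
  by move=> _ n m nm; rewrite lee_fin ler_nat upcrossings_le.
have iU : P.-integrable setT (fun x => limn (U ^~ x)).
  apply: (integrable_limn_nondecreasing mU) => [n x|x n m nm|n].
  - exact: U0.
  - exact: ndU.
  - exact: upcrossings_expectation (XK n).
apply: filterS (integrable_ae measurableT iU) => x /(_ I) fin [oa ob].
have [N KU] := upcrossings_unbounded (ltW ab) oa ob
  (Num.truncn (fine (limn (U ^~ x)))).+1.
have : (U N x <= limn (U ^~ x))%E.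
  apply: lime_ge; first by apply: ereal_nondecreasing_is_cvgn; exact: ndU.
  near=> n; apply: ndU => //; near: n.
  exact: nbhs_infty_ge.
rewrite -(fineK fin) lee_fin => UL.
have := truncnS_gt (fine (limn (U ^~ x))).
by rewrite ltNge (le_trans _ UL)// ler_nat.
Unshelve. all: by end_near. Qed.

End ExpectedUpcrossings.

(** The lower limit is defined and measurable without any assumption on
convergence, and does not depend on a measure: one variable serves as the limit
under all measures of a family. *)
Definition limit_rv X : T -> R :=
  fun x => fine (limn_einf (fun m => (X m x)%:E)).

Lemma measurable_limit_rv X :
  (forall m, measurable_fun setT (X m)) -> measurable_fun setT (limit_rv X).
Proof.
move=> mX; apply: measurableT_comp => //; apply: measurable_limn_einf => m.
exact/measurable_EFinP.
Qed.

(** Doob's theorem for processes bounded in L1. Upcrossings exclude oscillation,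
which leaves a limit in the extended reals; Fatou's lemma applied to |X_m|
excludes an infinite limit. *)
Theorem fair_cvg P F X K : filtration F -> fair_process P F X ->
  (forall m, (\int[P]_x `|X m x|%:E <= K%:E)%E) ->
  {ae P, forall x, X m x @[m --> \oo] --> limit_rv X x}.
Proof.
move=> hF fX XK.
have mX m : measurable_fun setT (X m).
  by have [_ iX _] := fX; exact: integrable_rv_measurable.
have osc : {ae P, forall x, forall p q : rat, p < q ->
    ~ oscillates (ratr p) (ratr q) (X ^~ x)}.
  suff : {ae P, forall x n, let pq := odflt (0, 0) (unpickle n) : rat * rat in
      pq.1 < pq.2 -> ~ oscillates (ratr pq.1) (ratr pq.2) (X ^~ x)}.
    by apply: filterS => x H p q; have := H (pickle (p, q)); rewrite pickleK.
  apply/ae_foralln => n /=; case: (odflt _ _) => p q /=.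
  have [pq|pq] := boolP (p < q); last exact: nearW.
  have pqR : ratr p < ratr q :> R by rewrite ltr_rat.
  by apply: filterS (ae_nonoscillating hF fX pqR XK).
pose N (m : nat) x : \bar R := `|X m x|%:E.
have mN m : measurable_fun setT (N m).
  by apply/measurable_EFinP; exact: measurableT_comp.
have N0 m x : setT x -> (0 <= N m x)%E by move=> _; rewrite lee_fin.
have einf0 x : (0 <= limn_einf (N ^~ x))%E.
  rewrite limn_einf_lim; apply: lime_ge; first exact: is_cvg_einfs.
  by apply: nearW => n; apply: le_ereal_inf_tmp => _ [k _ <-]; exact: N0.
have iN : P.-integrable setT (fun x => limn_einf (N ^~ x)).
  apply/integrableP; split.
    exact: measurable_limn_einf.
  under eq_integral do rewrite gee0_abs//.
  apply: le_lt_trans (fatou _ _ mN N0) _ => //.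
  apply: (@le_lt_trans _ _ K%:E); last exact: ltry.
  rewrite limn_einf_lim; apply: lime_le; first exact: is_cvg_einfs.
  apply: nearW => n; apply: le_trans (XK n).
  by apply: ereal_inf_lbound; exists n => /=.
apply: filterS2 osc (integrable_ae measurableT iN) => x.
move=> /nonoscillating_cvg cX /(_ I).
have cN : `|(X m x)%:E|%E @[m --> \oo] --> `|limn_einf (EFin \o X ^~ x)|%E.
  exact: cvg_abse.
rewrite (cvg_limn_einf_sup cN).1 abse_fin_num => fin.
by move: cX; rewrite -[X in _ --> X -> _](fineK fin) => /fine_cvg.
Qed.

(** A dominated fair process is bounded in L1, hence converges; on an event of
[F m] the integrals of X_n are constant from n = m on, and dominated convergence
passes this constant to the limit. *)
Lemma fair_closed P F X (Z : T -> \bar R) :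
  filtration F -> fair_process P F X ->
  P.-integrable setT Z -> {ae P, forall x m, (`|X m x|%:E <= Z x)%E} ->
  [/\ {ae P, forall x, X m x @[m --> \oo] --> limit_rv X x},
      integrable_rv P (limit_rv X) &
      forall m, is_condexp P (F m) (limit_rv X) (X m)].
Proof.
move=> hF fX iZ XZ; have [aX iX _] := fX; have [_ _ FT] := hF.
have mX m : measurable_fun setT (X m) by exact: integrable_rv_measurable.
have mZ := measurable_int P iZ.
have XK m : (\int[P]_x `|X m x|%:E <= (fine (\int[P]_x `|Z x|))%:E)%E.
  rewrite fineK; last first.
    by apply: integrable_fin_num => //; exact: integrable_abse.
  apply: ae_ge0_le_integral => //.
  - by apply/measurable_EFinP; exact: measurableT_comp.
  - exact: measurableT_comp.
  - by apply: filterS XZ => x H _; rewrite (le_trans (H m))// lee_abs.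
have cX := fair_cvg hF fX XK.
have mL : measurable_fun setT (limit_rv X) by exact: measurable_limit_rv.
have dom A : measurable A -> P.-integrable A (EFin \o limit_rv X) /\
    (\int[P]_(x in A) (X n x)%:E @[n --> \oo] -->
     \int[P]_(x in A) (limit_rv X x)%:E)%E.
  move=> mA.
  have [] // := @dominated_convergence _ _ _ P A mA (fun n => EFin \o X n)
    (EFin \o limit_rv X) Z.
  - by move=> n; apply/measurable_EFinP; exact: measurable_funTS.
  - by apply/measurable_EFinP; exact: measurable_funTS.
  - by apply: filterS cX => x cXx _; apply: cvg_EFin; [exact: nearW|exact: cXx].
  - exact: (integrableS measurableT).
  - by apply: filterS XZ => x H n _; exact: H.
have iL : integrable_rv P (limit_rv X) by have [] := dom setT measurableT.
split => // m; split => // A FA.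
have mA : measurable A by exact: FT FA.
have [_ cA] := dom A mA.
apply: (cvg_unique _ _ cA) => //; apply: cvg_near_cst; near=> n.
have mn : (m <= n)%N by near: n; exact: nbhs_infty_ge.
by rewrite -!EFin_Rintegral// (fair_Rintegral hF fX mn FA).
Unshelve. all: by end_near. Qed.
End Doob.

(** * Maximal chains *)

(** Hausdorff's maximal principle for chains through a given element: Zorn's
lemma is applied to the sets that remain chains after adding [g], since a
maximal one among them contains [g]. *)
Lemma maximal_chain_exists (U : Type) (le : U -> U -> Prop)
    (A : set U) (g : U) :
  (forall x, le x x) -> A g -> exists2 C, maximal_chain le A C & C g.
Proof.
move=> le_refl Ag.
pose P C := C `<=` A /\ total_on (C `|` [set g]) le.
have [S SP Stot|C [[CA Ctot] Cmax]] := @Zorn_bigcup U P.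
  split=> [x [C SC Cx]|x y]; first by have [+ _] := SP _ SC; apply.
  move=> [[C SC Cx]|->] [[D SD Dy]|->].
  - have [CD|DC] := Stot _ _ SC SD.
      by have [_] := SP _ SD; apply; left => //; exact: CD.
    by have [_] := SP _ SC; apply; left => //; exact: DC.
  - by have [_] := SP _ SC; apply; [left|right].
  - by have [_] := SP _ SD; apply; [right|left].
  - by left.
have Cg : C g.
  apply: contrapT => nCg; apply: (Cmax (C `|` [set g])).
    split; first by move=> x Cx; left.
    by move=> /(_ g) H; apply/nCg/H; right.
  split; first by move=> x [/CA|->].
  by rewrite -setUA setUid.
have Cg' : C `|` [set g] = C by apply/seteqP; split=> x; [case=> // ->|left].
exists C => //; split => //; first by rewrite -Cg'.
move=> C' C'A C'tot CC'; apply/seteqP; split => //.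
apply: contrapT => C'C; apply: (Cmax C'); first by split.
split => //; rewrite (_ : C' `|` _ = C')//.
by apply/seteqP; split=> x; [case=> // ->; exact: CC'|left].
Qed.

(** * The compensator common to all measures *)

Section CommonCompensator.
Context {d : measure_display} {T : measurableType d} {R : realType}.
Implicit Types (P : probability T R) (F : nat -> set (set T)).
Implicit Types (f g h : nat -> T -> R) (M : set (probability T R)).

Lemma measurable_wrt_trivial (X : T -> R) x y :
  measurable_wrt [set set0; setT] X -> X x = X y.
Proof.
have sG : sigma_algebra setT [set set0; setT : set T].
  split; first by left.
    by move=> A [->|->]; [right; rewrite setD0|left; rewrite setDv].
  move=> A HA; have [[n An]|nA] := pselect (exists n, A n = setT).
    by right; apply/seteqP; split => // z _; exists n => //; rewrite An.
  left; apply/seteqP; split => // z [n _]; have [->//|An] := HA n.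
  by exfalso; apply: nA; exists n.
move=> /(measurable_wrtP sG) /(_ [set X y] (measurable_set1 _)).
by move=> [E|E]; [have : set0 y by rewrite -E|have : setT x by []; rewrite -E].
Qed.

Lemma measurable_wrt_le (G G' : set (set T)) (X : T -> R) :
  sigma_algebra setT G -> sigma_algebra setT G' -> G `<=` G' ->
  measurable_wrt G X -> measurable_wrt G' X.
Proof.
move=> sG sG' GG' /(measurable_wrtP sG) mX; apply/(measurable_wrtP sG') => B mB.
exact/GG'/mX.
Qed.

Lemma bounded_ratios_self P : bounded_ratios (fun _ : 'I_1 => P) 1 1.
Proof.
by move=> _ _; apply: filterS (Radon_Nikodym_self P) => x ->; rewrite lexx.
Qed.

Lemma convex_comb_self P : convex_comb (fun _ : 'I_1 => P) P.
Proof.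
exists (fun=> 1); split => //; first by rewrite big_ord1.
by move=> A _; rewrite big_ord1 mul1e.
Qed.

Lemma integrable_rv_ge0 P (X : T -> R) : measurable_fun setT X ->
  {ae P, forall x, 0 <= X x} -> ('E_P[X] < +oo)%E -> integrable_rv P X.
Proof.
move=> mX X0; rewrite unlock => EX; apply/integrableP; split.
  exact/measurable_EFinP.
apply: le_lt_trans EX; rewrite le_eqVlt; apply/orP; left; apply/eqP.
apply: ae_eq_integral => //.
- by apply: measurableT_comp => //; exact/measurable_EFinP.
- exact/measurable_EFinP.
- by apply: filterS X0 => x /= X0 _; rewrite ger0_norm.
Qed.

(** [gbar m] is the increment from time [m - 1] to time [m]; hence the shift. *)
Definition running_sum (gbar : nat -> T -> R) m x : R :=
  \sum_(i < m) gbar i.+1 x.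

Lemma running_sum_adapted F gbar : filtration F -> adapted F gbar ->
  adapted F (running_sum gbar).
Proof.
move=> hF agbar m; have [sF _ _] := hF.
have mgbar (i : 'I_m) : measurable_wrt (F m) (gbar i.+1).
  by apply: measurable_wrt_le (agbar i.+1) => //; exact: filtration_le.
rewrite /measurable_wrt /running_sum.
exact: measurable_sum.
Qed.

Lemma running_sumS gbar m :
  running_sum gbar m.+1 = running_sum gbar m \+ gbar m.+1.
Proof. by apply/funext => x; rewrite /running_sum big_ord_recr. Qed.

Lemma running_sum_integrable P gbar : (forall m, integrable_rv P (gbar m)) ->
  forall m, integrable_rv P (running_sum gbar m).
Proof.
move=> ig; elim=> [|m ih]; last by rewrite running_sumS; exact: integrable_rvD.
rewrite (_ : running_sum gbar 0 = cst 0); first exact: integrable0.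
by apply/funext => x; rewrite /running_sum big_ord0.
Qed.

Lemma fair_compensated P F f gbar : filtration F -> adapted F f ->
  adapted F gbar -> (forall m, integrable_rv P (f m)) ->
  (forall m, integrable_rv P (gbar m)) ->
  (forall m A, F m A ->
     \int[P]_(x in A) f m.+1 x + \int[P]_(x in A) gbar m.+1 x =
     \int[P]_(x in A) f m x) ->
  fair_process P F (fun m => f m \+ running_sum gbar m).
Proof.
move=> hF af agbar iF ig fg; have [sF _ FT] := hF.
have iacc := running_sum_integrable ig.
split => [m|m|m A FA].
- apply: (@measurable_funD _ (g_sigma_algebraType (F m))); first exact: af.
  exact: running_sum_adapted.
- exact: integrable_rvD.
- have mA : measurable A by exact: FT FA.
  rewrite !RintegralD_rv// running_sumS RintegralD_rv// -(fg m A FA).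
  by rewrite -!addrA; congr (_ + _); rewrite addrC.
Qed.

(** For the one-member family P, the martingale f + g^s gives the drift of f as
minus that of g^s, and g^s has the drift of gbar; eliminating g^s, which may
depend on P, leaves an identity between f and gbar. *)
Lemma regular_compensator F M f :
  filtration F -> F 0%N = [set set0; setT] -> regular_supermartingale F M f ->
  exists g, [/\ adapted F g, forall x, g 0%N x = 0,
    forall m, as_all M (fun x => g m x <= g m.+1 x),
    forall P, M P -> forall m, integrable_rv P (f m) /\ integrable_rv P (g m) &
    forall P, M P -> fair_process P F (fun m => f m \+ g m)].
Proof.
move=> hF F0 [[af i1f _] _ [gbar [agbar gbar0 gbar00 Egbar fam]]].
have [sF Fle FT] := hF.
have if_ P m : M P -> integrable_rv P (f m).
  case: m => [MP|m MP]; last exact: i1f.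
  rewrite (_ : f 0%N = cst (f 0%N point)).
    exact: finite_measure_integrable_cst.
  apply/funext => x; apply: measurable_wrt_trivial.
  by rewrite -F0; exact: af.
have igbar P m : M P -> integrable_rv P (gbar m).
  case: m => [MP|m MP].
    rewrite (_ : gbar 0%N = cst 0); first exact: integrable0.
    exact/funext.
  apply: integrable_rv_ge0; last exact: Egbar.
    exact: measurable_wrt_fun (sF _) (FT _) _ (agbar _).
  exact: gbar0.
have fairP P : M P ->
    fair_process P F (fun m => f m \+ running_sum gbar m).
  move=> MP; apply: fair_compensated => // [m|m|m A FA].
  - exact: if_.
  - exact: igbar.
  have mA : measurable A by exact: FT FA.
  (* the one-member family, whose only density is 1 *)
  have [] := fam 0%N (fun=> P) 1 1 (fun=> MP) ltr01 (@bounded_ratios_self P).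
  move=> _ [Gs [gs [[Gsc _ _] [Gsgs _] mart gsgbar]]].
  have [ags gs0 _ [_ ifgs _]] := Gsc _ Gsgs.
  have PP := convex_comb_self P.
  have ifgs1 := ifgs m.+1 P isT PP.
  have igs k : integrable_rv P (gs k).
    case: k => [|k].
      rewrite (_ : gs 0%N = cst 0); first exact: integrable0.
      exact/funext.
    exact: integrable_rv_addKl (ifgs k.+1 P isT PP) (if_ P k.+1 MP).
  have mgt X : integrable_rv P X -> measurable_fun setT (condexp P (F m) X).
    move=> iX; apply: integrable_rv_measurable.
    exact: (condexp_integrable (sF m) (FT m) iX).
  have := ae_eq_Rintegral mA (mgt _ ifgs1) _ (mart m m.+1 ord0 (leqnSn _) isT).
  have := ae_eq_Rintegral mA (mgt _ (integrable_rvB (igs m.+1) (igs m)))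
    (mgt _ (igbar P m.+1 MP)) (gsgbar m.+1 ord0 isT).
  rewrite !(Rintegral_condexp (sF m) (FT m))//;
    [|exact: igbar|exact: integrable_rvB].
  rewrite RintegralB_rv// => eg /(_ _) ef.
  have := ef (integrable_rv_measurable (integrable_rvD (if_ P m MP) (igs m))).
  rewrite !RintegralD_rv//; [|exact: if_..].
  lra.
exists (running_sum gbar); split.
- exact: running_sum_adapted.
- by move=> x; rewrite /running_sum big_ord0.
- move=> m P MP; apply: filterS (gbar0 m.+1 P MP) => x gx.
  by rewrite /running_sum big_ord_recr/= lerDl.
- move=> P MP m; split; first exact: if_.
  by apply: running_sum_integrable => k; exact: igbar.
- exact: fairP.
Qed.

(** The expectations of g_m = (f_m + g_m) - f_m are bounded because f + g has a
constant expectation; hence the limit of g is integrable, and together with the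
bound [phi] on f it dominates f + g. *)
Lemma fair_dominated P F f g (phi : T -> R) : filtration F ->
  fair_process P F (fun m => f m \+ g m) ->
  (forall m, integrable_rv P (f m)) -> (forall m, integrable_rv P (g m)) ->
  (forall x, g 0%N x = 0) ->
  (forall m, {ae P, forall x, g m x <= g m.+1 x}) ->
  integrable_rv P phi -> (forall m, {ae P, forall x, `|f m x| <= phi x}) ->
  exists2 Z : T -> \bar R, P.-integrable setT Z &
    {ae P, forall x m, (`|f m x + g m x|%:E <= Z x)%E}.
Proof.
move=> hF fX if_ ig g0 ndg iphi fphi; have [_ _ FT] := hF.
(* the total variation of g: almost surely equal to g, and non-decreasing
   everywhere, as monotone convergence requires *)
pose U n x : R := \sum_(i < n) `|g i.+1 x - g i x|.
have mg m : measurable_fun setT (g m) by exact: integrable_rv_measurable.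
have mf m : measurable_fun setT (f m) by exact: integrable_rv_measurable.
have mU n : measurable_fun setT (U n).
  apply: measurable_sum => i; apply: measurableT_comp => //.
  exact: measurable_funB.
have U0 n x : 0 <= U n x by exact: sumr_ge0.
have Ug : {ae P, forall x n, U n x = g n x}.
  apply: filterS (ae_foralln ndg) => x ndx n.
  elim: n => [|n ih]; first by rewrite /U big_ord0 g0.
  by rewrite /U big_ord_recr/= -/(U n x) ih ger0_norm ?subr_ge0// addrC subrK.
have ndU x : {homo U ^~ x : n m / (n <= m)%N >-> (n <= m)}.
  by apply/nondecreasing_seqP => n; rewrite /U big_ord_recr/= lerDl.
have UK n : (\int[P]_x (U n x)%:E <=
    (\int[P]_x (f 0%N x + g 0%N x) + \int[P]_x phi x)%:E)%E.
  rewrite (@ae_eq_integral _ _ _ _ _ (EFin \o g n))//; first last.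
  - by apply: filterS Ug => x /= H _; rewrite H.
  - exact/measurable_EFinP.
  - exact/measurable_EFinP.
  rewrite /= -EFin_Rintegral// lee_fin.
  have F0T : F 0%N setT.
    by have [sF _ _] := hF; rewrite -(measurable_g_measurableTypeE (sF 0%N)).
  have := fair_Rintegral hF fX (leq0n n) F0T; rewrite /= => <-.
  rewrite RintegralD_rv//.
  have : \int[P]_(x in setT) (cst 0 x) <= \int[P]_x (f n x + phi x).
    apply: ae_le_Rintegral => //; [exact: integrable0|exact: integrable_rvD|].
    apply: filterS (fphi n) => x; rewrite ler_norml => /andP[fx _].
    by rewrite -lerBlDr sub0r.
  rewrite RintegralD_rv// Rintegral_cst// mul0r; lra.
exists (fun x => (phi x)%:E + limn (fun n => (U n x)%:E))%E.
  apply: integrableD => //.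
  apply: integrable_limn_nondecreasing (UK) => //.
  by move=> n; exact/measurable_EFinP.
apply: filterS2 Ug (ae_foralln fphi) => x Ugx fx m.
rewrite (le_trans (y := (`|f m x| + `|g m x|)%:E))//.
  by rewrite lee_fin ler_normD.
rewrite EFinD leeD// ?lee_fin//.
rewrite -Ugx ger0_norm//.
apply: lime_ge.
  by apply: ereal_nondecreasing_is_cvgn => n k nk; rewrite lee_fin; exact: ndU.
near=> n; rewrite lee_fin; apply: ndU; near: n; exact: nbhs_infty_ge.
Unshelve. all: by end_near. Qed.

Lemma fair_supermartingale F M X : filtration F ->
  adapted F X -> (forall P, M P -> fair_process P F X) ->
  supermartingale F M X /\ martingale F M X.
Proof.
move=> hF aX fX; have [sF _ FT] := hF.
have E k m : (k <= m)%N -> forall P, M P ->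
    {ae P, forall x, condexp P (F k) (X m) x = X k x}.
  move=> km P MP; apply: (is_condexp_ae_eq (sF k) (FT k)).
  exact: fair_condexp (fX P MP) km.
have iX m P : (1 <= m)%N -> M P -> integrable_rv P (X m).
  by move=> _ /fX[].
split; split => // k m km P MP.
by apply: filterS (E k m km P MP) => x ->.
Qed.

Lemma probability1_ae P (A : set T) : measurable A ->
  P A = 1%E <-> {ae P, forall x, A x}.
Proof.
move=> mA; split=> [PA|/negligibleP PA].
  apply/negligibleP; first exact: measurableC.
  by rewrite [LHS]probability_setC// PA subee.
have : P (~` A) = 0%E by apply: PA; exact: measurableC.
rewrite probability_setC// => /eqP.
by rewrite sube_eq ?fin_num_adde_defr// add0e => /eqP <-.
Qed.

(** Among the compensators, one that turns f into a martingale is maximal: a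
larger one would have a strictly larger expectation at some time, against the
supermartingale inequality from time 0, where both have the value f_0. *)
Lemma fair_compensator_maximal F M f g h :
  filtration F -> F 0%N = [set set0; setT] ->
  (forall P, M P -> forall m, integrable_rv P (f m) /\ integrable_rv P (g m)) ->
  (forall x, g 0%N x = 0) ->
  (forall P, M P -> fair_process P F (fun m => f m \+ g m)) ->
  compensators F M f h -> proc_le M g h -> proc_le M h g.
Proof.
move=> hF F0 ifg g0 fX [ah h0 _ [_ iX hX]] gh m m1 P MP.
have [sF _ FT] := hF.
have [if_ ig] := ifg P MP m; have ifh := iX m P m1 MP.
have ih : integrable_rv P (h m).
  exact: integrable_rv_addKl ifh if_.
have F0T : F 0%N setT by rewrite F0; right.
have mg := integrable_rv_measurable ig; have mh := integrable_rv_measurable ih.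
have hg : \int[P]_x (h m x - g m x) <= 0.
  have : \int[P]_x condexp P (F 0%N) (f m \+ h m) x <=
      \int[P]_x (f 0%N x + g 0%N x).
    apply: ae_le_Rintegral => //.
    - exact: (condexp_integrable (sF 0%N) (FT 0%N)).
    - by apply: integrable_rvD; have [] := ifg P MP 0%N.
    - by apply: filterS (hX 0%N m (leq0n m) P MP) => x; rewrite g0 /= h0.
  rewrite (Rintegral_condexp (sF 0%N) (FT 0%N))//.
  have := fair_Rintegral hF (fX P MP) (leq0n m) F0T; rewrite /= => <-.
  by rewrite /= RintegralB_rv// !RintegralD_rv//; lra.
have mhg : measurable_fun setT (h m \- g m) by exact: measurable_funB.
have msub (u v : T -> R) : measurable_fun setT u -> measurable_fun setT v ->
    measurable [set x | 0 <= u x - v x].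
  move=> mu mv; rewrite -[X in measurable X]setTI.
  have := measurable_funB mu mv measurableT (measurable_itv `[0, +oo[).
  rewrite (_ : _ @^-1` _ = [set x | 0 <= u x - v x])//.
  by apply/seteqP; split=> x /=; rewrite in_itv/= andbT.
have hg0 : {ae P, forall x, 0 <= h m x - g m x}.
  by apply/(probability1_ae _ (msub _ _ mh mg)); exact: gh.
have mE : measurable_fun setT (EFin \o (h m \- g m)) by exact/measurable_EFinP.
apply/(probability1_ae _ (msub _ _ mg mh)).
apply: filterS ((ae_eq_integral_abs P measurableT mE).1 _) => [x|].
  move=> /(_ I) /= [E].
  by rewrite /= -opprB E oppr0.
apply/eqP; rewrite eq_le; apply/andP; split; last exact: integral_ge0.
rewrite (@ae_eq_integral _ _ _ P setT (EFin \o (h m \- g m)))//.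
- by rewrite -EFin_Rintegral ?lee_fin//; exact: integrable_rvB.
- exact: measurableT_comp.
- by apply: filterS hg0 => x /= E _; rewrite ger0_norm.
Qed.

End CommonCompensator.

(** * The theorem *)

Theorem theorem3 (d : measure_display) (T : measurableType d) (R : realType)
    (F : nat -> set (set T)) (M : set (probability T R)) (f : nat -> T -> R)
    (hF : filtration F) (hF0 : F 0%N = [set set0; setT])
    (hconv : convex_measures M) (hequiv : equivalent_measures M)
    (hreg : regular_supermartingale F M f) :
  exists (Gt : set (nat -> T -> R)) (g0 : nat -> T -> R),
    [/\ maximal_chain (proc_le M) (compensators F M f) Gt,
        maximal_element (proc_le M) Gt g0,
        forall m P0, (1 <= m)%N -> M P0 ->
          forall x, 'E_P0[f m \+ g0 m]%E = (f 0%N x)%:E &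
        exists Mbar : nat -> T -> R,
          [/\ martingale F M Mbar,
              forall m, (1 <= m)%N ->
                as_all M (fun x => f m x = Mbar m x - g0 m x) &
              exists fginf : T -> R,
                [/\ measurable_fun setT fginf,
                    as_all M (fun x =>
                      f m x + g0 m x @[m --> \oo] --> fginf x),
                    forall P0, M P0 -> integrable_rv P0 fginf &
                    forall m P0, (1 <= m)%N -> M P0 ->
                      {ae P0, forall x,
                        Mbar m x = condexp P0 (F m) fginf x}]]].
Proof.
have [sF _ FT] := hF.
have [g [ag g0 ndg ifg fX]] := regular_compensator hF hF0 hreg.
have [[af _ _] [phi [B [mphi fphi Ephi]]] _] := hreg.
pose X m := f m \+ g m.
have aX : adapted F X.
  move=> m; apply: (@measurable_funD _ (g_sigma_algebraType (F m))).
    exact: af.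
  exact: ag.
have [superX martX] := fair_supermartingale hF aX fX.
have gM : compensators F M f g by [].
have le_refl h : proc_le M h h.
  move=> m _ P MP; rewrite (_ : [set _ | _] = setT) ?probability_setT//.
  by apply/seteqP; split => x //= _; rewrite subrr.
have [C Cmax Cg] := maximal_chain_exists le_refl gM.
have closed P : M P ->
    [/\ {ae P, forall x, X m x @[m --> \oo] --> limit_rv X x},
        integrable_rv P (limit_rv X) &
        forall m, is_condexp P (F m) (limit_rv X) (X m)].
  move=> MP.
  have iphi : integrable_rv P phi.
    apply: integrable_rv_ge0 => //; last first.
      exact: lt_le_trans (Ephi P MP) (leey _).
    by apply: filterS (fphi 0%N P MP) => x; exact: le_trans.
  have [Z iZ XZ] := fair_dominated hF (fX P MP)
    (fun m => (ifg P MP m).1) (fun m => (ifg P MP m).2) g0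
    (fun m => ndg m P MP) iphi (fun m => fphi m P MP).
  exact: fair_closed hF (fX P MP) iZ XZ.
exists C, g; split => //.
- split => // h Ch; have [CM _ _] := Cmax.
  exact: fair_compensator_maximal hF hF0 ifg g0 fX (CM _ Ch).
- move=> m P m1 MP x.
  have F0T : F 0%N setT by rewrite hF0; right.
  have [_ iX _] := fX P MP.
  rewrite unlock -EFin_Rintegral//.
  rewrite (fair_Rintegral hF (fX P MP) (leq0n m) F0T).
  rewrite (_ : (fun y => (f 0%N \+ g 0%N) y) = cst (f 0%N x)).
    by rewrite Rintegral_cst// [X in fine X]probability_setT mulr1.
  apply/funext => y /=; rewrite g0 addr0; apply: measurable_wrt_trivial.
  by rewrite -hF0; exact: af.
- exists X; split => //.
    by move=> m _ P _; apply: nearW => x; rewrite /X /= addrK.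
  exists (limit_rv X); split.
  + apply: measurable_limit_rv => m.
    exact: measurable_wrt_fun (sF m) (FT m) _ (aX m).
  + by move=> P MP; have [] := closed P MP.
  + by move=> P MP; have [] := closed P MP.
  + move=> m P _ MP; have [_ _ cX] := closed P MP.
    by apply: filterS (is_condexp_ae_eq (sF m) (FT m) (cX m)) => x ->.
Qed.
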